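(* For every finite poset $P$ there exists a constant $c(P)$, depending only on $P$, such that for every $n\ge 1$ and every prime power $q$, every family $\mathcal{V}$ of subspaces of $\mathbb{F}_q^n$ which contains no copy of $P$ satisfies $$l_q(\mathcal{V})=\sum_{V\in\mathcal{V}}\frac{1}{\binom{n}{\dim V}_q}\le c(P).$$
   Context: $\binom{n}{k}_q=\prod_{0\le i\le k-1}\frac{q^{n-i}-1}{q^{k-i}-1}$ is the Gaussian binomial coefficient (the number of $k$-dimensional subspaces of $\mathbb{F}_q^n$). A family $\mathcal{V}$ of subspaces, ordered by inclusion, contains a copy of $P$ (as a subposet) if there is an injective map $\psi:P\to\mathcal{V}$ such that $u\le_P v$ implies $\psi(u)\subseteq\psi(v)$. *)

(* Defs.v *)
From HB Require Import structures.
From mathcomp Require Import all_boot all_order all_algebra.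

Set Implicit Arguments.
Unset Strict Implicit.
Unset Printing Implicit Defensive.

Import Order.TTheory GRing.Theory Num.Theory.
Local Open Scope ring_scope.

(* Over a finite field a space has finitely many subspaces, so a family of    *)
(* subspaces is a finite set {set {vspace vT}}. The subType structure (by     *)
(* reduced matrices) that yields it is exported only by the module below.     *)
Import VectorInternalTheory.
HB.instance Definition _ (F : finFieldType) (vT : vectType F) :=
  [Finite of {vspace vT} by <:].

(* The truncated subtractions are exact for k <= n, the only case used.       *)
Definition gauss_binomial (q n k : nat) : rat :=
  \prod_(0 <= i < k)
     ((q%:R ^+ (n - i) - 1) / (q%:R ^+ (k - i) - 1)).

(* Weak containment: incomparable elements may have comparable images.        *)
Definition contains_copy (d : Order.disp_t) (P : finPOrderType d)
    (F : finFieldType) (vT : vectType F) (VV : {set {vspace vT}}) : Prop :=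
  exists psi : P -> {vspace vT},
    [/\ injective psi,
        forall u, psi u \in VV
      & forall u v, (u <= v)%O -> (psi u <= psi v)%VS].

Definition lubell (q n : nat) (F : finFieldType)
    (VV : {set {vspace 'rV[F]_n}}) : rat :=
  \sum_(V in VV) (gauss_binomial q n (\dim V))^-1.

(* Main.v *)
(**
A linear extension of P embeds P into any chain of #|P| subspaces, so it
suffices to bound the Lubell sum by k for a family VV with no chain of more than
k members. Let L(U) be the Lubell sum of the members of VV above U, computed in
the quotient by U. Counting the vectors outside U of each member shows that
L(U) = [U in VV] + the average of L(U + <x>) over the vectors x outside U, and
the bound follows by induction on the codimension of U: if U is in VV, the
chains available strictly above it have at most k - 1 members.
*)

Require Import Defs.
From mathcomp Require Import all_boot all_order all_algebra.
From mathcomp Require Import finfield zify ring.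

Set Implicit Arguments.
Unset Strict Implicit.
Unset Printing Implicit Defensive.

Import Order.TTheory GRing.Theory Num.Theory.
Local Open Scope ring_scope.

Lemma gauss_binomial0 (q n : nat) : gauss_binomial q n 0 = 1.
Proof. by rewrite /gauss_binomial big_geq. Qed.

Lemma gauss_binomialSS (q n k : nat) :
  gauss_binomial q n.+1 k.+1 =
  (q%:R ^+ n.+1 - 1) / (q%:R ^+ k.+1 - 1) * gauss_binomial q n k.
Proof. by rewrite /gauss_binomial big_nat_recl. Qed.

(** Since q^n - q^u = q^u (q^(n-u) - 1), and likewise for v, this is the recurrence
    [gauss_binomialSS] scaled by q^u. It compares the weight of one member in the quotients by U and
    by U + <x>. *)
Lemma gauss_binomial_quotient (q u v n : nat) :
  (1 < q)%N -> (u < v)%N -> (v <= n)%N ->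
  (q%:R ^+ n - q%:R ^+ u) / gauss_binomial q (n - u) (v - u) =
  (q%:R ^+ v - q%:R ^+ u) / gauss_binomial q (n - u.+1) (v - u.+1).
Proof.
move=> q_gt1 ltuv levn.
have [a ->] : exists a, n = (u + a.+1)%N by exists (n - u.+1)%N; lia.
have [b ->] : exists b, v = (u + b.+1)%N by exists (v - u.+1)%N; lia.
rewrite !subnS !addKn /= gauss_binomialSS !invfM.
have q_neq1 (m : nat) : q%:R ^+ m.+1 - 1 != 0 :> rat.
  by rewrite subr_eq0 gt_eqF // exprn_egt1 // ltr1n.
rewrite invrK !mulrA; congr (_ / _); rewrite !exprD.
by field; rewrite !q_neq1.
Qed.

Section RelativeLubell.

Variables (F : finFieldType) (n : nat).
Local Notation vT := 'rV[F]_n.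
Local Notation q := #|F|.
Implicit Types (U V : {vspace vT}) (x : vT).

(** Chains are lists [s] with [pairwise propv s], smallest member first; strictness makes the
    entries distinct, so [size s] counts members. *)
Definition propv U V := (U <= V)%VS && (U != V).

Definition lubell_above (VV : {set {vspace vT}}) U : rat :=
  \sum_(V in VV | (U <= V)%VS)
     (gauss_binomial q (n - \dim U) (\dim V - \dim U))^-1.

Lemma dim_rVf : \dim (fullv : {vspace vT}) = n.
Proof. by rewrite dimvf /dim /= mul1n. Qed.

Lemma dim_rV_le U : (\dim U <= n)%N.
Proof. by rewrite -[leqRHS]dim_rVf dimvS ?subvf. Qed.

Lemma propv_dim U V : propv U V -> (\dim U < \dim V)%N.
Proof.
case/andP=> sUV neqUV; rewrite ltn_neqAle dimvS // andbT.
by apply: contra neqUV => eqd; rewrite eqEdim sUV (eqP eqd) leqnn.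
Qed.

Lemma dim_add_line U x : x \notin U -> \dim (U + <[x]>) = (\dim U).+1.
Proof.
move=> xU; rewrite dimv_disjoint_sum ?dim_vector ?dim_vline.
  by rewrite (_ : x != 0) ?addn1 //; apply: contraNneq xU => ->; rewrite mem0v.
apply/eqP; rewrite -subv0; apply/subvP=> y /memv_capP[yU /vlineP[a def_y]].
rewrite memv0; case: (eqVneq a 0) => [a0|a0]; first by rewrite def_y a0 scale0r.
by case/negP: xU; rewrite -(scalerK a0 x) -def_y memvZ.
Qed.

Lemma sum_vspaceD U V (c : rat) : (U <= V)%VS ->
  \sum_(x | (x \in V) && (x \notin U)) c =
  (q%:R ^+ \dim V - q%:R ^+ \dim U) * c.
Proof.
move=> sUV; rewrite sumr_const -[LHS]mulr_natl; congr (_ * c).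
rewrite -!natrX -!card_vspace -(cardID (mem U) (mem V)) natrD.
rewrite (_ : #|[predI (mem V) & (mem U)]| = #|U|).
  rewrite addrAC subrr add0r; congr (_%:R); apply: eq_card => x.
  by rewrite !inE andbC.
by apply: eq_card => x; rewrite !inE; apply/andb_idl/subvP.
Qed.

(** Double counting of pairs (x, V): a member V strictly above U occurs once for each x in V outside
    U. Multiplying by the number of vectors outside U avoids a division. *)
Lemma lubell_above_average (VV : {set {vspace vT}}) U :
  (q%:R ^+ n - q%:R ^+ \dim U) * lubell_above VV U =
  (q%:R ^+ n - q%:R ^+ \dim U) * (U \in VV)%:R
  + \sum_(x | x \notin U) lubell_above VV (U + <[x]>).
Proof.
rewrite /lubell_above (exchange_big_dep (fun V => (V \in VV) && propv U V)) /=.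
  rewrite (bigID (pred1 U)) /= mulrDr; congr (_ * _ + _).
    case UVV: (U \in VV).
      rewrite (big_pred1 U) ?subnn ?gauss_binomial0 ?invr1 // => V /=.
      by case: eqP => [->|]; rewrite ?andbF // UVV subvv.
    rewrite big1 // => V /andP[/andP[VVV _] /eqP eVU].
    by rewrite -eVU VVV in UVV.
  rewrite mulr_sumr; apply: eq_big => [V|V].
    by rewrite /propv andbA (eq_sym U).
  case/andP=> /andP[VVV sUV] neqVU.
  have ltUV : (\dim U < \dim V)%N.
    by apply: propv_dim; rewrite /propv eq_sym neqVU sUV.
  have leVn := dim_rV_le V.
  (* The weight of V above U + <x> is the same for every admissible x, as each x raises the
     dimension by exactly one. *)
  set c := (gauss_binomial q (n - (\dim U).+1) (\dim V - (\dim U).+1))^-1.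
  transitivity (\sum_(x | (x \in V) && (x \notin U)) c); last first.
    apply: eq_big => [x|x].
      by rewrite VVV subv_add sUV -memvE andbC.
    by case/andP=> _ /dim_add_line ->.
  by rewrite sum_vspaceD // /c gauss_binomial_quotient ?finNzRing_gt1.
move=> x V xU /andP[->]; rewrite subv_add -memvE /propv => /andP[-> xV] /=.
by apply: contraNneq xU => ->.
Qed.

Lemma lubell_above_chain_bound (VV : {set {vspace vT}}) U (k : nat) :
  (forall s, pairwise propv s ->
     all (fun V => (V \in VV) && (U <= V)%VS) s -> (size s <= k)%N) ->
  lubell_above VV U <= k%:R.
Proof.
have q_gt1 : 1 < q%:R :> rat by rewrite ltr1n finNzRing_gt1.
have [m] := ubnP (n - \dim U); elim: m U k => // m IHm U k lem chains.
(* The one-element chain U makes the later subtraction k - [U in VV] exact in [nat]. *)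
have k_ge : (U \in VV <= k)%N.
  case UVV: (U \in VV) => //.
  by apply: (chains [:: U]); rewrite //= UVV subvv.
(* When U is the whole space there is no x to average over, and U is the only possible member above
   itself. *)
have [leUn | ltUn] := leqP n (\dim U).
  have Ufull : U = fullv.
    by apply/eqP; rewrite eqEdim subvf dim_rVf.
  apply: le_trans (_ : (U \in VV)%:R <= _); last by rewrite ler_nat.
  rewrite /lubell_above (eq_bigl (fun V => (V \in VV) && (V == U))); last first.
    by move=> V; rewrite Ufull (eqEsubv V) subvf.
  case UVV: (U \in VV); last first.
    by rewrite big1 // => V /andP[VVV /eqP eVU]; rewrite -eVU VVV in UVV.
  rewrite (big_pred1 U) ?subnn ?gauss_binomial0 ?invr1 // => V /=.
  by case: eqP => [->|]; rewrite ?andbF // UVV.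
have D_gt0 : 0 < q%:R ^+ n - q%:R ^+ \dim U :> rat.
  by rewrite subr_gt0 ltr_eXn2l.
(* The right side becomes a sum of the constant k - [U in VV] over the vectors outside U, to be
   compared term by term. *)
rewrite -(ler_pM2l D_gt0) lubell_above_average -lerBrDl -mulrBr -natrB //.
rewrite -[X in q%:R ^+ X - _]dim_rVf -sum_vspaceD ?subvf //.
rewrite [leRHS](eq_bigl (fun x => x \notin U)); last by move=> x; rewrite memvf.
apply: ler_sum => x xU; apply: IHm => [|s s_chain /allP sVV].
  by rewrite dim_add_line //; lia.
(* Members above U + <x> contain x, hence lie strictly above U; so U can be put in front of the
   chain when it belongs to [VV]. *)
have sU V : V \in s -> (V \in VV) && propv U V.
  move/sVV=> /andP[->]; rewrite subv_add -memvE /propv => /andP[-> xV] /=.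
  by apply: contraNneq xU => ->.
case UVV: (U \in VV); last first.
  rewrite subn0; apply: chains => //.
  by apply/allP=> V /sU/andP[-> /andP[->]].
have := chains (U :: s); rewrite /= UVV subvv s_chain /= andbT => chainUs.
rewrite UVV in k_ge.
rewrite leq_subRL // add1n; apply: chainUs.
  by apply/allP=> V /sU/andP[].
by apply/allP=> V /sU/andP[-> /andP[->]].
Qed.

Lemma lubell_chain_bound (VV : {set {vspace vT}}) (k : nat) :
  (forall s, pairwise propv s -> {subset s <= VV} -> (size s <= k)%N) ->
  lubell q VV <= k%:R.
Proof.
move=> chains; have -> : lubell q VV = lubell_above VV 0%VS.
  rewrite /lubell_above dimv0 subn0.
  by apply: eq_big => V; rewrite ?sub0v ?andbT ?subn0.
apply: lubell_above_chain_bound => s s_chain /allP sVV; apply: chains => // V.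
by case/sVV/andP.
Qed.

End RelativeLubell.

(** The size of the down-set grows strictly along the order, so positions in a list of P sorted by
    that size do too. *)
Lemma linear_extension (d : Order.disp_t) (P : finPOrderType d) :
  exists f : P -> nat,
    [/\ injective f, forall u, (f u < #|P|)%N
      & forall u v, (u <= v)%O -> (f u <= f v)%N].
Proof.
pose h (u : P) := #|[pred x | (x <= u)%O]|.
have h_lt u v : (u < v)%O -> (h u < h v)%N.
  move=> ltuv; apply/proper_card/properP; split.
    by apply/subsetP=> x; rewrite !inE => /le_trans; apply; apply: ltW.
  by exists v; rewrite !inE ?lexx // (lt_geF ltuv).
pose e := relpre h leq; pose s := sort e (enum P).
have e_trans : transitive e by move=> x y z; apply: leq_trans.
have s_sorted : sorted e s by apply: sort_sorted => x y; apply: leq_total.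
have in_s u : u \in s by rewrite mem_sort mem_enum.
exists (index^~ s); split=> [u v|u|u v].
- exact: index_inj.
- by rewrite cardT -(size_sort e) index_mem.
rewrite le_eqVlt => /predU1P[-> //|/h_lt]; apply: contraTleq => ltvu.
by rewrite -leqNgt; apply: (sorted_ltn_index e_trans s_sorted).
Qed.

Lemma chain_contains_copy (d : Order.disp_t) (P : finPOrderType d)
    (F : finFieldType) (n : nat) (VV : {set {vspace 'rV[F]_n}})
    (s : seq {vspace 'rV[F]_n}) :
  pairwise (@propv F n) s -> {subset s <= VV} -> (#|P| <= size s)%N ->
  contains_copy P VV.
Proof.
move=> s_chain sVV lePs; have [f [f_inj f_lt f_mono]] := linear_extension P.
have ltfs u : (f u < size s)%N by apply: leq_trans (f_lt u) lePs.
have nth_lt u v : (f u < f v)%N -> propv (nth 0%VS s (f u)) (nth 0%VS s (f v)).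
  by move/(pairwiseP 0%VS s_chain); apply; rewrite inE.
exists (fun u => nth 0%VS s (f u)); split=> [u v|u|u v].
(* Different positions in a strict chain hold different subspaces. *)
- move=> eq_uv; apply: f_inj; apply/eqP; case: ltngtP => // /nth_lt /andP[_].
    by rewrite eq_uv eqxx.
  by rewrite eq_uv eqxx.
- by apply/sVV/mem_nth.
- by move/f_mono; rewrite leq_eqVlt => /predU1P[-> //|/nth_lt/andP[]].
Qed.

Theorem theorem1p10 (d : Order.disp_t) (P : finPOrderType d) :
  exists c : rat,
    forall (n q : nat) (F : finFieldType) (VV : {set {vspace 'rV[F]_n}}),
      (1 <= n)%N -> #|F| = q ->
      ~ contains_copy P VV ->
      lubell q VV <= c.
Proof.
exists #|P|%:R => n q F VV _ <- noP; apply: lubell_chain_bound => s s_chain sVV.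
by rewrite leqNgt; apply/negP => /ltnW /(chain_contains_copy s_chain sVV).
Qed.
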